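(* If $n$ is large enough, then every $p\in S_n$ has a monotone $2$-inverse-additive subsequence of length three.
   Context: $S_n$ denotes the set of permutations of $\{1,2,\ldots,n\}$ written in one-line notation $p=(p_1,p_2,\ldots,p_n)$. A subsequence of $p$ of length $k$ is a sequence $(p_{i_1},\ldots,p_{i_k})$ with $i_1<\cdots<i_k$. A sequence is monotone if it is increasing or decreasing. A sequence $(a_1,a_2,\ldots,a_k)$ of positive integers is $2$-inverse-additive if $1/a_1+1/a_2+\cdots+1/a_k=2/a_1$ or $1/a_1+1/a_2+\cdots+1/a_k=2/a_k$. *)

(* Defs.v *)
From mathcomp Require Import all_boot all_order all_algebra all_fingroup.
Set Implicit Arguments.
Unset Strict Implicit.
Unset Printing Implicit Defensive.
Import GRing.Theory.

(* 'S_n permutes {0, ..., n-1}; the shift by one makes the entries range over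
   {1, ..., n}. *)
Definition one_line (n : nat) (p : 'S_n) : seq nat :=
  [seq (val (p i)).+1 | i <- enum 'I_n].

Definition monotone_seq (s : seq nat) : bool := sorted ltn s || sorted gtn s.

(* Nonemptiness is explicit because [head] and [last] take the default value 0
   on the empty sequence. *)
Definition two_inverse_additive (s : seq nat) : Prop :=
  [/\ s != [::],
      all (fun a => 0 < a) s &
      ((\sum_(a <- s) (a%:R : rat)^-1 = 2%:R / (head 0%N s)%:R)%R \/
       (\sum_(a <- s) (a%:R : rat)^-1 = 2%:R / (last 0%N s)%:R)%R)].

(* Main.v *)
Require Import Defs.
From mathcomp Require Import all_boot all_order all_algebra all_fingroup.

(** The values [N / k] with [k <= 72], where [N = 72`!], turn the statement
    into an additive one: for [a < b] the entries [N / a > N / b > N / (a + b)] have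
    reciprocals [a / N], [b / N] and [(a + b) / N], which add up to twice the
    last of them.  Hence these entries, read in increasing or in decreasing
    order, form a 2-inverse-additive sequence, and they are a monotone
    subsequence of [p] exactly when [N / b] stands between the other two.
    Comparing the positions of the entries [N / k] orders [1, ..., 72], so it
    remains to show that every linear order on [1, ..., 72] places some [b]
    between some [a < b] and [a + b] ([ex_middle_summand]).

    Suppose that an order [r] never does so.  Then [b] has [a] and [a + b] on
    the same side, so the order of [a] and [b] decides the order of [b] and
    [a + b], and conversely.  Applied repeatedly, and combined with
    transitivity, this makes a few comparisons force many others.  Assuming
    that [1] precedes both [2] and [3], the forced comparisons become
    contradictory.  The hypothesis on [r] is invariant under reversal and, for
    a smaller bound, under dilation, so in fact every [d <= 4] separates
    [2 * d] from [3 * d] ([double_triple_opposite]).  With this additional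
    rule, and [1] before [2] up to reversal, each of the two ways to order [1]
    and [4] leads to a contradiction ([one_before_two]). *)

Set Implicit Arguments.
Unset Strict Implicit.
Unset Printing Implicit Defensive.

(** * Orders with no larger summand between the smaller one and the sum *)

Record no_middle_summand (m : nat) (r : rel nat) : Prop := NoMiddleSummand {
  nms_irr : irreflexive r;
  nms_trans : transitive r;
  nms_total : forall x y, 0 < x <= m -> 0 < y <= m -> x != y -> r x y || r y x;
  nms_left : forall a b, [&& 0 < a, a < b & a + b <= m] ->
    r a b <-> r (a + b) b;
  nms_right : forall a b, [&& 0 < a, a < b & a + b <= m] ->
    r b a <-> r b (a + b)
}.

Lemma no_middle_summand_converse m r :
  no_middle_summand m r -> no_middle_summand m (fun x y => r y x).
Proof.
move=> [irr tr tot L R]; split=> //.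
- by move=> y x z ryx rzy; apply: tr rzy ryx.
- by move=> x y xm ym xy; rewrite orbC tot.
Qed.

Lemma no_middle_summand_dilate d m n r : 0 < d -> d * m <= n ->
  no_middle_summand n r -> no_middle_summand m (relpre (muln d) r).
Proof.
move=> d0 dmn [irr tr tot L R].
have dil a b : [&& 0 < a, a < b & a + b <= m] ->
    [&& 0 < d * a, d * a < d * b & d * a + d * b <= n].
  case/and3P=> a0 ab abm; rewrite muln_gt0 d0 a0 ltn_pmul2l // ab -mulnDr /=.
  by rewrite (leq_trans _ dmn) // leq_mul2l abm orbT.
have bnd x : 0 < x <= m -> 0 < d * x <= n.
  case/andP=> x0 xm; rewrite muln_gt0 d0 x0 /=.
  by rewrite (leq_trans _ dmn) // leq_mul2l xm orbT.
split=> [x|y x z|x y xm ym xy|a b ab|a b ab] /=.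
- exact: irr.
- exact: tr.
- by apply: tot; rewrite ?bnd // eqn_pmul2l.
- by rewrite mulnDr; apply: L; apply: dil.
- by rewrite mulnDr; apply: R; apply: dil.
Qed.

Lemma no_middle_summand_asym m r x y :
  no_middle_summand m r -> r x y -> r y x -> False.
Proof.
by move=> [irr tr _ _ _] rxy ryx; move: (tr _ _ _ rxy ryx); rewrite irr.
Qed.

(** Forced comparisons close up to a contradiction between [3] and [8].
    [rx_y] is the comparison [r x y]; a step through [L a b] or [R a b]
    exchanges [a] and [a + b] on one side of [b], in the direction [.1] for
    introducing the sum and [.2] for removing it. *)
Lemma one_before_two_three r :
  no_middle_summand 18 r -> r 1 2 -> r 1 3 -> False.
Proof.
move=> rm r1_2 r1_3; have [_ tr _ L R] := rm.
have r3_2 : r 3 2 := (L 1 2 isT).1 r1_2.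
have r3_5 : r 3 5 := (R 2 3 isT).1 r3_2.
have r8_5 : r 8 5 := (L 3 5 isT).1 r3_5.
have r8_13 : r 8 13 := (R 5 8 isT).1 r8_5.
have r1_5 : r 1 5 := tr _ _ _ r1_3 r3_5.
have r6_5 : r 6 5 := (L 1 5 isT).1 r1_5.
have r6_11 : r 6 11 := (R 5 6 isT).1 r6_5.
have r4_3 : r 4 3 := (L 1 3 isT).1 r1_3.
have r4_7 : r 4 7 := (R 3 4 isT).1 r4_3.
have r11_7 : r 11 7 := (L 4 7 isT).1 r4_7.
have r6_7 : r 6 7 := tr _ _ _ r6_11 r11_7.
have r13_7 : r 13 7 := (L 6 7 isT).1 r6_7.
have r8_7 : r 8 7 := tr _ _ _ r8_13 r13_7.
have r8_15 : r 8 15 := (R 7 8 isT).1 r8_7.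
have r4_2 : r 4 2 := tr _ _ _ r4_3 r3_2.
have r4_6 : r 4 6 := (R 2 4 isT).1 r4_2.
have r4_11 : r 4 11 := tr _ _ _ r4_6 r6_11.
have r15_11 : r 15 11 := (L 4 11 isT).1 r4_11.
have r11_18 : r 11 18 := (R 7 11 isT).1 r11_7.
have r15_18 : r 15 18 := tr _ _ _ r15_11 r11_18.
have r15_3 : r 15 3 := (R 3 15 isT).2 r15_18.
have r8_3 : r 8 3 := tr _ _ _ r8_15 r15_3.
have r10_6 : r 10 6 := (L 4 6 isT).1 r4_6.
have r6_18 : r 6 18 := tr _ _ _ r6_11 r11_18.
have r10_18 : r 10 18 := tr _ _ _ r10_6 r6_18.
have r10_8 : r 10 8 := (R 8 10 isT).2 r10_18.
have r2_8 : r 2 8 := (L 2 8 isT).2 r10_8.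
have r3_8 : r 3 8 := tr _ _ _ r3_2 r2_8.
exact: no_middle_summand_asym rm r3_8 r8_3.
Qed.

(** The previous contradiction transported to the multiples of [d], where
    totality turns the failure of [r d (d * 3)] into its converse. *)
Lemma double_triple_opposite m r d :
    no_middle_summand m r -> 0 < d -> d * 18 <= m ->
  r d (d * 2) -> r (d * 3) d.
Proof.
move=> rm d0 dm r12.
have sm := no_middle_summand_dilate d0 dm rm.
have /orP[r13|//] := nms_total sm (x := 1) (y := 3) isT isT isT; last first.
  by rewrite /= muln1.
by case: (one_before_two_three sm _ r13); rewrite /= muln1.
Qed.

(** The bound [72 = 4 * 18] lets [double_triple_opposite] be used at
    [d = 1, 2, 3, 4]. *)
Lemma one_before_two r : no_middle_summand 72 r -> r 1 2 -> False.
Proof.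
move=> rm r1_2; have [_ tr tot L R] := rm.
have A d := double_triple_opposite (d := d) rm.
have A' d := double_triple_opposite (d := d) (no_middle_summand_converse rm).
have r3_1 : r 3 1 := A 1 isT isT r1_2.
have r3_2 : r 3 2 := tr _ _ _ r3_1 r1_2.
have /orP[r1_4|r4_1] := tot 1 4 isT isT isT.
- have r3_5 : r 3 5 := (R 2 3 isT).1 r3_2.
  have r8_5 : r 8 5 := (L 3 5 isT).1 r3_5.
  have r5_4 : r 5 4 := (L 1 4 isT).1 r1_4.
  have r8_4 : r 8 4 := tr _ _ _ r8_5 r5_4.
  have r4_12 : r 4 12 := A' 4 isT isT r8_4.
  have r1_12 : r 1 12 := tr _ _ _ r1_4 r4_12.
  have r13_12 : r 13 12 := (L 1 12 isT).1 r1_12.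
  have r5_9 : r 5 9 := (R 4 5 isT).1 r5_4.
  have r3_9 : r 3 9 := tr _ _ _ r3_5 r5_9.
  have r12_9 : r 12 9 := (L 3 9 isT).1 r3_9.
  have r12_21 : r 12 21 := (R 9 12 isT).1 r12_9.
  have r8_13 : r 8 13 := (R 5 8 isT).1 r8_5.
  have r21_13 : r 21 13 := (L 8 13 isT).1 r8_13.
  have r12_13 : r 12 13 := tr _ _ _ r12_21 r21_13.
  exact: no_middle_summand_asym rm r12_13 r13_12.
- have r4_2 : r 4 2 := tr _ _ _ r4_1 r1_2.
  have r2_6 : r 2 6 := A' 2 isT isT r4_2.
  have r4_6 : r 4 6 := tr _ _ _ r4_2 r2_6.
  have r10_6 : r 10 6 := (L 4 6 isT).1 r4_6.
  have r10_16 : r 10 16 := (R 6 10 isT).1 r10_6.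
  have r3_4 : r 3 4 := (R 1 3 isT).1 r3_1.
  have r7_4 : r 7 4 := (L 3 4 isT).1 r3_4.
  have r7_2 : r 7 2 := tr _ _ _ r7_4 r4_2.
  have r7_9 : r 7 9 := (R 2 7 isT).1 r7_2.
  have r16_9 : r 16 9 := (L 7 9 isT).1 r7_9.
  have r10_9 : r 10 9 := tr _ _ _ r10_16 r16_9.
  have r3_6 : r 3 6 := tr _ _ _ r3_2 r2_6.
  have r9_3 : r 9 3 := A 3 isT isT r3_6.
  have r9_1 : r 9 1 := tr _ _ _ r9_3 r3_1.
  have r9_10 : r 9 10 := (R 1 9 isT).1 r9_1.
  exact: no_middle_summand_asym rm r9_10 r10_9.
Qed.

Lemma no_middle_summand_bound r : no_middle_summand 72 r -> False.
Proof.
move=> rm; have /orP[] := nms_total rm (x := 1) (y := 2) isT isT isT.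
- exact: one_before_two.
- exact: one_before_two (no_middle_summand_converse rm).
Qed.

Lemma ex_middle_summand (r : rel nat) : irreflexive r -> transitive r ->
    (forall x y, 0 < x <= 72 -> 0 < y <= 72 -> x != y -> r x y || r y x) ->
  exists a b, [/\ 0 < a < b, a + b <= 72 &
    r a b && r b (a + b) || r (a + b) b && r b a].
Proof.
move=> irr tr tot.
pose mid (a b : 'I_73) := [&& 0 < a < b, a + b <= 72 &
  r a b && r b (a + b) || r (a + b) b && r b a].
case: (boolP [exists a, exists b, mid a b]) => [|nomid].
  by case/existsP=> a /existsP[b /and3P[]]; exists (val a), (val b).
have asym x y : r x y -> ~~ r y x.
  by move=> rxy; apply/negP=> ryx; move: (tr _ _ _ rxy ryx); rewrite irr.
have sides a b : [&& 0 < a, a < b & a + b <= 72] ->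
    [/\ ~~ (r a b && r b (a + b) || r (a + b) b && r b a),
        r a b || r b a & r b (a + b) || r (a + b) b].
  case/and3P=> a0 ab abm.
  have b0 := ltn_trans a0 ab.
  have bm : b <= 72 := leq_trans (leq_addl a b) abm.
  have am : a <= 72 := leq_trans (leq_addr b a) abm.
  split; last 2 first.
  - by apply: tot; rewrite ?a0 ?b0 // neq_ltn ab.
  - apply: tot; rewrite ?b0 ?addn_gt0 ?a0 //.
    by rewrite neq_ltn -{1}[b]add0n ltn_add2r a0.
  apply: contra nomid => midab.
  apply/existsP; exists (inord a); apply/existsP; exists (inord b).
  by rewrite /mid !inordK // a0 ab abm.
(* By [sides] and asymmetry the four comparisons of [b] with [a] and [a + b]
   have only two possible joint values, which are read off by cases. *)
case: (@no_middle_summand_bound r); split=> // a b /sides[];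
  move: (@asym a b) (@asym b a) (@asym b (a + b)) (@asym (a + b) b);
  by do 4?case: (r _ _); (split=> //) || move=> // h1 h2 h3 h4; split.
Qed.

(** * Reciprocals of the entries [N / k] *)

Lemma inv_natr_divn (N k : nat) : 0 < N -> k %| N ->
  ((N %/ k)%:R : rat)^-1%R = (k%:R / N%:R)%R.
Proof.
move=> N0 kN; have k0 := dvdn_gt0 N0 kN.
have kR : (k%:R != 0 :> rat)%R by rewrite Num.Theory.pnatr_eq0 -lt0n.
rewrite -{2}(divnK kN) GRing.natrM GRing.invfM GRing.mulrCA.
by rewrite GRing.divff // GRing.mulr1.
Qed.

Lemma sum_inv_divn (N a b : nat) : 0 < N -> a %| N -> b %| N -> a + b %| N ->
  (((N %/ a)%:R : rat)^-1 + (N %/ b)%:R^-1 + (N %/ (a + b))%:R^-1 =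
    2%:R / (N %/ (a + b))%:R)%R.
Proof.
move=> N0 aN bN cN; rewrite !inv_natr_divn // -!GRing.mulrDl GRing.mulrA.
by rewrite -!GRing.natrD -GRing.natrM mul2n addnn.
Qed.

Lemma two_inverse_additive_divn (N a b : nat) :
    0 < N -> a %| N -> b %| N -> a + b %| N ->
  two_inverse_additive [:: N %/ a; N %/ b; N %/ (a + b)] /\
  two_inverse_additive [:: N %/ (a + b); N %/ b; N %/ a].
Proof.
move=> N0 aN bN cN.
have pos k : k %| N -> 0 < N %/ k.
  by move=> kN; rewrite divn_gt0 ?(dvdn_gt0 N0) // dvdn_leq.
have E := sum_inv_divn N0 aN bN cN.
split; split; rewrite //= ?pos //.
- by right; rewrite !big_cons big_nil GRing.addr0 GRing.addrA.
- left; rewrite !big_cons big_nil GRing.addr0 -E.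
  by rewrite GRing.addrC GRing.addrAC GRing.addrC GRing.addrA.
Qed.

Lemma ltn_divn2l N a b : 0 < N -> a %| N -> b %| N -> a < b -> N %/ b < N %/ a.
Proof.
move=> N0 aN bN ab; have a0 := dvdn_gt0 N0 aN.
rewrite ltn_divRL // -(ltn_pmul2r (leq_ltn_trans (leq0n a) ab)).
rewrite mulnAC divnK // ltn_pmul2l //.
Qed.

(** * Subsequences from positions *)

(** The sequence of indices is an increasing subsequence of the enumeration of
    all the indices of [s], and [t] and [s] are the images of the two under
    [nth]. *)
Lemma subseq_sorted_index (T : eqType) (s t : seq T) : {subset t <= s} ->
  sorted (relpre (index^~ s) ltn) t -> subseq t s.
Proof.
case: t => [|x0 t]; first by rewrite sub0seq.
set u := x0 :: t => us ut.
pose w := map (index^~ s) u.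
have sw : sorted ltn w by rewrite sorted_map.
have -> : u = map (nth x0 s) w.
  rewrite -map_comp -[LHS]map_id; apply/eq_in_map=> x /us xs /=.
  by rewrite nth_index.
rewrite -[X in subseq _ X](mkseq_nth x0); apply: map_subseq.
have -> : w = [seq i <- iota 0 (size s) | i \in w].
  apply: (irr_sorted_eq ltn_trans ltnn) => //.
    by apply: sorted_filter (iota_ltn_sorted _ _); apply: ltn_trans.
  move=> i; rewrite mem_filter mem_iota add0n /=.
  apply/idP/andP=> [iw|[]//]; split=> //.
  by case/mapP: iw => x /us xs ->; rewrite index_mem.
exact: filter_subseq.
Qed.

Lemma mem_one_line n (p : 'S_n) v : 0 < v <= n -> v \in one_line p.
Proof.
case: v => // v vn; apply/mapP; exists ((p^-1)%g (Ordinal vn)).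
  by rewrite mem_enum.
by rewrite permKV.
Qed.

Theorem corollary6p6 :
  exists N : nat, forall n : nat, N <= n -> forall p : 'S_n,
    exists s : seq nat,
      [/\ subseq s (one_line p), size s = 3, monotone_seq s
        & two_inverse_additive s].
Proof.
(* The factorial is kept opaque so that it is never computed. *)
have [N [N0 divN]] : exists N, 0 < N /\ forall k, 0 < k <= 72 -> k %| N.
  by exists (72`!); split=> [|k]; [apply: fact_gt0 | apply: dvdn_fact].
exists N => n Nn p.
pose v k := N %/ k; pose pos k := index (v k) (one_line p).
have vp k : 0 < k <= 72 -> v k \in one_line p.
  move=> k72; apply: mem_one_line; rewrite (leq_trans (leq_div _ _) Nn) andbT.
  by rewrite divn_gt0 ?(dvdn_gt0 N0) ?divN // dvdn_leq ?divN.
have vlt a b : 0 < a -> a < b -> b <= 72 -> v b < v a.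
  move=> a0 ab bm; apply: ltn_divn2l => //; apply: divN.
    by rewrite a0 (leq_trans (ltnW ab)).
  by rewrite (ltn_trans a0).
have pos_total x y : 0 < x <= 72 -> 0 < y <= 72 -> x != y ->
    (pos x < pos y) || (pos y < pos x).
  move=> xm ym; rewrite -neq_ltn; apply: contra_neq.
  move=> /(congr1 (nth 0 (one_line p))).
  rewrite !nth_index ?vp // => vxy.
  move: xm ym => /andP[x0 xm] /andP[y0 ym].
  case: (ltngtP x y) => // [xy|yx].
  - by move: (vlt x y x0 xy ym); rewrite vxy ltnn.
  - by move: (vlt y x y0 yx xm); rewrite vxy ltnn.
have [|||a [b [/andP[a0 ab] abm mid]]] :=
  @ex_middle_summand (fun x y => pos x < pos y).
- by move=> x; rewrite ltnn.
- by move=> y x z; apply: ltn_trans.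
- exact: pos_total.
have b0 := ltn_trans a0 ab.
have bm : b <= 72 := leq_trans (leq_addl a b) abm.
have am : a <= 72 := leq_trans (leq_addr b a) abm.
have bc : b < a + b by rewrite -{1}[b]add0n ltn_add2r.
have a72 : 0 < a <= 72 by rewrite a0.
have b72 : 0 < b <= 72 by rewrite b0.
have c72 : 0 < a + b <= 72 by rewrite addn_gt0 a0.
have [inc dec] :=
  two_inverse_additive_divn N0 (divN _ a72) (divN _ b72) (divN _ c72).
have vab := vlt _ _ a0 ab bm; have vbc := vlt _ _ b0 bc abm.
case/orP: mid => /andP[pos1 pos2].
- exists [:: v a; v b; v (a + b)]; split=> //; last first.
    by rewrite /monotone_seq /= vab vbc orbT.
  apply: subseq_sorted_index; last by rewrite /= pos1 pos2.
  by move=> x; rewrite !inE => /or3P[] /eqP->; apply: vp.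
- exists [:: v (a + b); v b; v a]; split=> //; last first.
    by rewrite /monotone_seq /= vab vbc.
  apply: subseq_sorted_index; last by rewrite /= pos1 pos2.
  by move=> x; rewrite !inE => /or3P[] /eqP->; apply: vp.
Qed.
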